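(* Let $F$ be a finite field with $q$ elements and $G$ a finite abelian group of order $m$. Let $r\in(0,1)$ and $\delta\in(0,1-q^{-1})$. For each positive integer $n$ put $k=[rn]$ (the integer nearest to $rn$), and let $A=(a_{ij})$ be a $k\times n$ matrix over the group algebra $FG$ chosen uniformly at random from $(FG)^{k\times n}$. Let $C_A=\{\mathbf{b}A \mid \mathbf{b}\in (FG)^k\}\subseteq (FG)^n$ and let $\Delta(C_A)$ be its relative distance. Then $$\lim_{n\to\infty}\Pr\big(\Delta(C_A)>\delta\big)=\begin{cases}1,& \text{if } r<g_q(\delta),\\ 0,& \text{if } r>g_q(\delta),\end{cases}$$ and both limits converge exponentially fast.
   Context: Each element $a=\sum_{z\in G}a_z z$ of $FG$ ($a_z\in F$) is identified with the word $(a_z)_{z\in G}\in F^m$, and an element $(a_1,\dots,a_n)\in(FG)^n$ with the concatenated word of length $mn$ over $F$; its Hamming weight is $\mathrm{w}(a_1,\dots,a_n)=\sum_i\mathrm{w}(a_i)$. For $\mathbf{b}=(b_1,\dots,b_k)\in(FG)^k$, $\mathbf{b}A=(\sum_i b_ia_{i1},\dots,\sum_i b_ia_{in})$ with products in $FG$. The relative distance is $\Delta(C_A)=\mathrm{w}(C_A)/(mn)$ where $\mathrm{w}(C_A)$ is the minimum Hamming weight of the nonzero codewords. The $q$-ary entropy is $h_q(x)=x\log_q(q-1)-x\log_q x-(1-x)\log_q(1-x)$ (with $0\log_q 0=0$), and $g_q(x)=1-h_q(x)$ is the GV-bound. *)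

(* Defs.v *)
From HB Require Import structures.
From mathcomp Require Import all_boot all_order all_algebra.
From mathcomp Require Import all_classical all_reals all_analysis.
Set Implicit Arguments. Unset Strict Implicit. Unset Printing Implicit Defensive.
Import Order.TTheory GRing.Theory Num.Theory.
Local Open Scope ring_scope.

(* Elements of the group algebra FG are finite functions G -> F
   (a = sum_z a_z z is identified with the word (a_z)_{z in G}).
   The finite abelian group G is written additively (finZmodType). *)
Section GroupAlgebra.
Variables (F : finFieldType) (G : finZmodType).

Definition gmul (a b : {ffun G -> F}) : {ffun G -> F} :=
  [ffun z => \sum_(x : G) a x * b (z - x)].

Definition codeword (k n : nat) (b : {ffun 'I_k -> {ffun G -> F}})
    (A : 'M[{ffun G -> F}]_(k, n)) : {ffun 'I_n -> {ffun G -> F}} :=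
  [ffun j => [ffun z => \sum_(i < k) gmul (b i) (A i j) z]].

Definition hweight (n : nat) (c : {ffun 'I_n -> {ffun G -> F}}) : nat :=

  (\sum_(j < n) #|[set z : G | c j z != 0%R]|)%N.

Definition nonzero_word (n : nat) (c : {ffun 'I_n -> {ffun G -> F}}) : bool :=
  [exists j, exists z, c j z != 0].

(* w(C_A): minimum Hamming weight of the nonzero codewords of C_A
   (convention: m n if C_A = {0}) *)
Definition minwt (k n : nat) (A : 'M[{ffun G -> F}]_(k, n)) : nat :=
  \big[minn/(#|G| * n)%N]_(b : {ffun 'I_k -> {ffun G -> F}}
                           | nonzero_word (codeword b A)) hweight (codeword b A).

Definition relDist (R : realType) (k n : nat) (A : 'M[{ffun G -> F}]_(k, n)) : R :=
  (minwt A)%:R / (#|G| * n)%:R.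

Definition prob_dist_gt (R : realType) (k n : nat) (delta : R) : R :=
  #|[set A : 'M[{ffun G -> F}]_(k, n) | delta < relDist R A]|%:R
  / #|{: 'M[{ffun G -> F}]_(k, n)}|%:R.

End GroupAlgebra.

(* q-ary entropy and GV bound, log_q x = ln x / ln q, 0 log 0 = 0 *)
Definition xlogq (R : realType) (q : nat) (x : R) : R :=
  if x == 0 then 0 else x * (ln x / ln q%:R).

Definition hq (R : realType) (q : nat) (x : R) : R :=
  x * (ln (q%:R - 1) / ln q%:R) - xlogq q x - xlogq q (1 - x).

Definition gq (R : realType) (q : nat) (x : R) : R := 1 - hq q x.

(* k = [r n], the integer nearest to r n (ties rounded up) *)
Definition nearest_k (R : realType) (r : R) (n : nat) : nat :=
  Num.truncn (r * n%:R + 2^-1).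

(* Main.v *)
Require Import Defs.
From HB Require Import structures.
From mathcomp Require Import all_boot all_order all_algebra.
From mathcomp Require Import all_classical all_reals all_analysis.
From mathcomp Require Import ring lra.
Set Implicit Arguments. Unset Strict Implicit. Unset Printing Implicit Defensive.
Import Order.TTheory GRing.Theory Num.Theory.
Import numFieldNormedType.Exports.
Import fintype.
Local Open Scope ring_scope.

(** Write q = #|F|.

    Below the GV bound, use the first moment. For fixed b the word b A is uniform on I^n,
    where I is the ideal of FG generated by the entries of b. If I has dimension d, then
    at most q^(d k) vectors b generate it. An ideal is invariant under translation by G,
    so the translates of an information set S of I cover every coordinate equally often;
    Jensen's inequality over these translates bounds the weight generating function of I
    by (1 + (q - 1) x)^d, and a Chernoff bound then shows that I^n contains at most
    q^(d n h_q(delta)) words of relative weight at most delta. The expected number of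
    light nonzero codewords is thus at most the sum over I of q^(d (k - n g_q(delta))).

    Above the GV bound, use the second moment on the one-dimensional ideal of FG spanned
    by the sum s of all group elements. For b = (s, beta_1 s, ..., beta_(k-1) s) the
    codeword b A is s times a word over F of the random linear code obtained from A by
    augmentation, with the same relative weight, and distinct beta give independent
    words. By Chebyshev's inequality the probability that no such word has weight
    j = floor(delta n) is at most q^(n-k+1) / (C(n, j) (q - 1)^j), and C(n, j) (q - 1)^j
    is q^(n h_q(delta)) up to a factor linear in n. *)

(** * Counting and exponential estimates *)

(** The maps [h] make all nonempty fibres of [f] equally large, so [f] carries the uniform
    distribution on [U] to the uniform one on its image. Cross-multiplying keeps this in the natural
    numbers. *)
Lemma card_preimset_homogeneous (U V : finType) (f : U -> V) (L : {set V}) :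
  (forall u1 u2 : U, exists2 h : U -> U,
     injective h & forall u, f u = f u1 -> f (h u) = f u2) ->
  (#|f @^-1: L| * #|f @: [set: U]| = #|L :&: f @: [set: U]| * #|U|)%N.
Proof.
move=> fhom.
have [u0|U0] := pickP (predT : pred U); last first.
  by rewrite (eq_card0 U0) (eq_card0 (A := f @^-1: L)) ?muln0 // => u; have := U0 u.
move=> _; pose K := #|[set u | f u == f u0]|.
have le_fiber u1 u2 : (#|[set u | f u == f u1]| <= #|[set u | f u == f u2]|)%N.
  have [h h_inj hf] := fhom u1 u2.
  rewrite -(card_imset _ h_inj); apply: subset_leq_card.
  by apply/subsetP=> _ /imsetP[u + ->]; rewrite !inE => /eqP/hf ->.
have card_pre (M : {set V}) : #|f @^-1: M| = (#|M :&: f @: [set: U]| * K)%N.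
  rewrite -sum1_card (partition_big f (mem (M :&: f @: [set: U]))) /=; last first.
    by move=> u; rewrite !inE => -> /=; apply: imset_f; rewrite inE.
  rewrite -sum_nat_const; apply: eq_bigr => y /setIP[+ /imsetP[u _ yE]]; rewrite {y}yE => My.
  rewrite sum1dep_card; transitivity #|[set v | f v == f u]|.
    apply: eq_card => v; rewrite !inE; case: eqP => [->|_]; last by rewrite andbF.
    by rewrite My.
  by apply/eqP; rewrite eqn_leq !le_fiber.
have UE : #|U| = (#|f @: [set: U]| * K)%N.
  by have := card_pre [set: V]; rewrite preimsetT finset.setTI cardsT.
by rewrite card_pre UE mulnAC mulnA.
Qed.

Lemma natr_card (R : pzSemiRingType) (U : finType) (P : {pred U}) :
  #|P|%:R = \sum_u (u \in P)%:R :> R.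
Proof.
rewrite -sum1_card natr_sum big_mkcond /=.
by apply: eq_bigr => u _; case: (u \in P).
Qed.

(* Chebyshev's inequality at 0 for a sum of pairwise independent indicators,
   in counting form. *)
Lemma card_no_event_le (R : realFieldType) (U T : finType) (E : T -> pred U) (p : R) :
  0 <= p ->
  (forall s, #|E s|%:R = p * #|U|%:R) ->
  (forall s t, s != t -> #|[pred u | E s u && E t u]|%:R = p ^+ 2 * #|U|%:R) ->
  #|[pred u | [forall s, ~~ E s u]]|%:R * (#|T|%:R * p) <= #|U|%:R.
Proof.
move=> p_ge0 E1 E2.
have [->|Np0] := eqVneq (#|T|%:R * p) 0; first by rewrite mulr0 ler0n.
have Np_gt0 : 0 < #|T|%:R * p by rewrite lt_def Np0 mulr_ge0 // ler0n.
set N := #|T|%:R in Np0 Np_gt0 *.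
(* [X] counts the events that hold at [u]; its mean is [N * p] and, by pairwise independence, its
   variance is at most its mean. Where no event holds, [X] is 0. *)
pose X (u : U) : R := \sum_s (E s u)%:R.
have sum1 s : \sum_u (E s u)%:R = p * #|U|%:R.
  by rewrite -(E1 s) natr_card.
have sumX : \sum_u X u = N * p * #|U|%:R.
  by rewrite exchange_big /= (eq_bigr _ (fun s _ => sum1 s)) sumr_const -[LHS]mulr_natl mulrA.
have sumX2 : \sum_u X u ^+ 2 <= N * p * #|U|%:R + N ^+ 2 * p ^+ 2 * #|U|%:R.
  under eq_bigr do rewrite expr2 mulr_suml.
  rewrite exchange_big /=.
  under eq_bigr do under eq_bigr do rewrite mulr_sumr.
  under eq_bigr do rewrite exchange_big /=.
  apply: (@le_trans _ _ (\sum_(s : T) (p * #|U|%:R + N * (p ^+ 2 * #|U|%:R)))).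
    apply: ler_sum => s _; rewrite (bigD1 s) //= lerD //.
      by under eq_bigr do rewrite -natrM mulnb andbb; rewrite sum1.
    rewrite (eq_bigr (fun=> p ^+ 2 * #|U|%:R)); last first.
      move=> t ts; rewrite -(E2 s t) 1?eq_sym // natr_card.
      by apply: eq_bigr => u _ /=; rewrite -natrM mulnb.
    rewrite sumr_const -[_ *+ _]mulr_natl ler_wpM2r ?mulr_ge0 ?exprn_ge0 ?ler0n //.
    by rewrite ler_nat max_card.
  by rewrite sumr_const -[_ *+ _]mulr_natl mulrDr -/N !mulrA -expr2.
have var : \sum_u (X u - N * p) ^+ 2 <= N * p * #|U|%:R.
  have -> : \sum_u (X u - N * p) ^+ 2 =
      \sum_u X u ^+ 2 - 2 * (N * p) * \sum_u X u + #|U|%:R * (N * p) ^+ 2.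
    have -> : #|U|%:R * (N * p) ^+ 2 = \sum_(u : U) (N * p) ^+ 2.
      by rewrite sumr_const [LHS]mulr_natl.
    by rewrite mulr_sumr -sumrB -big_split /=; apply: eq_bigr => u _; ring.
  rewrite sumX; move: sumX2; set S := \sum_u _ => sumX2; nra.
have low : #|[pred u | [forall s, ~~ E s u]]|%:R * (N * p) ^+ 2 <=
    \sum_u (X u - N * p) ^+ 2.
  rewrite -sum1_card natr_sum mulr_suml big_mkcond /=; apply: ler_sum => u _.
  case: ifP => [|_]; last exact: sqr_ge0.
  rewrite inE => /forallP nE; rewrite /X big1 => [|s _]; last by rewrite (negbTE (nE s)).
  by rewrite sub0r sqrrN mul1r.
by rewrite -(ler_pM2r Np_gt0) -mulrA -expr2 [leRHS]mulrC (le_trans low).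
Qed.

(** The tangent line of the exponential at the mean [a] lies below the graph, and its linear term
    sums to zero. *)
Lemma expR_sum_jensen (R : realType) (I : finType) (f : I -> R) :
  (0 < #|I|)%N ->
  expR ((\sum_i f i) / #|I|%:R) <= (\sum_i expR (f i)) / #|I|%:R.
Proof.
move=> I_gt0; have I0 : 0 < #|I|%:R :> R by rewrite ltr0n.
set a := _ / _; rewrite ler_pdivlMr //.
have aE : \sum_i f i = a * #|I|%:R by rewrite /a divfK ?gt_eqF.
have -> : expR a * #|I|%:R = \sum_i expR a * (1 + (f i - a)).
  rewrite -mulr_sumr big_split /= sumrB aE !sumr_const -[a *+ _]mulr_natr subrr addr0.
  by [].
apply: ler_sum => i _.
have -> : expR (f i) = expR a * expR (f i - a) by rewrite -expRD addrC subrK.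
by rewrite ler_pM2l ?expR_gt0 // expR_ge1Dx.
Qed.

Lemma expR_bound_extend (R : realType) (u : nat -> R) (c C : R) (n0 : nat) :
  0 < c -> (forall n, `|u n| <= 1) ->
  (forall n, (n0 <= n)%N -> `|u n| <= C * expR (- (c * n%:R))) ->
  exists c' C' : R, 0 < c' /\ forall n, `|u n| <= C' * expR (- (c' * n%:R)).
Proof.
move=> c_gt0 u1 uC; exists c, (`|C| + expR (c * n0%:R)); split=> // n.
have [le_n0n|lt_nn0] := leqP n0 n.
  apply: le_trans (uC n le_n0n) _; rewrite ler_wpM2r ?expR_ge0 //.
  by rewrite (le_trans (ler_norm C)) // lerDl expR_ge0.
apply: le_trans (u1 n) _; rewrite mulrDl -expRD.
rewrite -[leLHS]add0r lerD ?mulr_ge0 ?expR_ge0 //.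
rewrite -[leLHS]expR0 ler_expR subr_ge0 ler_wpM2l ?(ltW c_gt0) //.
by rewrite ler_nat ltnW.
Qed.

Lemma cvg_of_expR_bound (R : realType) (u : nat -> R) (l c C : R) :
  0 < c -> (forall n, `|u n - l| <= C * expR (- (c * n%:R))) ->
  (u n @[n --> \oo] --> l)%classic.
Proof.
move=> c_gt0 uC; apply/subr_cvg0/norm_cvg0P.
have C_ge0 : 0 <= C.
  by have := le_trans (normr_ge0 _) (uC 0%N); rewrite mulr0 oppr0 expR0 mulr1.
apply: (@squeeze_cvgr _ _ _ _ (fun=> 0) (geometric C (expR (- c)))).
- near=> n; rewrite normr_ge0 /=.
  by rewrite -expRM_natr mulNr uC.
- exact: cvg_cst.
- apply: cvg_geometric.
  by rewrite ger0_norm ?expR_ge0 // expR_lt1 oppr_lt0.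
Unshelve. all: by end_near.
Qed.

(** * Information sets and weights of translation-invariant codes *)

Definition supp (F : finFieldType) (G : finType) (a : {ffun G -> F}) : {set G} :=
  [set z | a z != 0].

Definition shift (F : finFieldType) (G : finZmodType) (x : G) (a : {ffun G -> F}) :
  {ffun G -> F} := [ffun z => a (z + x)].

Definition is_linear_code (F : finFieldType) (G : finType)
    (I : {set {ffun G -> F}}) : Prop :=
  [/\ 0 \in I, {in I &, forall a b, a + b \in I} &
      forall (t : F) a, a \in I -> [ffun z => t * a z] \in I].

(** Only injectivity of the restriction to [S] is asked; the matching size comes from
    [exists_information_set]. *)
Definition information_set (F : finFieldType) (G : finType)
    (I : {set {ffun G -> F}}) (S : {set G}) : Prop :=
  {in I &, forall a b : {ffun G -> F}, {in S, a =1 b} -> a = b}.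

Lemma prod_supp (R : comPzSemiRingType) (F : finFieldType) (G : finType) (x : R)
    (S : {set G}) (a : {ffun G -> F}) :
  \prod_(z in S) (if a z == 0 then 1 else x) = x ^+ #|supp a :&: S|.
Proof.
rewrite (bigID [pred z | a z == 0]) /= big1 => [|z /andP[_ ->]] //.
rewrite mul1r (eq_bigr (fun=> x)) => [|z /andP[_ /negbTE->]] //.
by rewrite prodr_const; congr (_ ^+ _); apply: eq_card => z; rewrite !inE andbC.
Qed.

(** Expanding the product over [S] of sums over [F], each equal to 1 + (q - 1) x, gives one term for
    each word supported in [S]. *)
Lemma sum_supp_pffun (R : realFieldType) (F : finFieldType) (G : finType) (x : R)
    (S : {set G}) :
  \sum_(f in pffun_on 0 S predT) x ^+ #|supp (f : {ffun G -> F}) :&: S| =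
  (1 + (#|F|%:R - 1) * x) ^+ #|S|.
Proof.
transitivity (\prod_(z in S) \sum_(y : F) (if y == 0 then 1 else x)); last first.
  rewrite prodr_const; congr (_ ^+ _); rewrite (bigD1 0) //= eqxx; congr (_ + _).
  rewrite (eq_bigr (fun=> x)) => [|y /negbTE->] //.
  rewrite sumr_const -[LHS]mulr_natl; congr (_ * _).
  have := cardC1 (0 : F); rewrite /predC1 => cE.
  rewrite (eq_card (B := predC1 (0 : F))) // cE -subn1 natrB //.
  by apply/card_gt0P; exists 0.
rewrite (big_distr_big_dep 0); apply: eq_bigr => f _.
by rewrite prod_supp.
Qed.

(** Restriction to [S], extended by zero, embeds [I] into the words supported in [S] and keeps the
    exponents; the other words add nonnegative terms. *)
Lemma sum_supp_information_set_le (R : realFieldType) (F : finFieldType) (G : finType)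
    (I : {set {ffun G -> F}}) (S : {set G}) (x : R) :
  0 <= x -> information_set I S ->
  \sum_(a in I) x ^+ #|supp a :&: S| <= (1 + (#|F|%:R - 1) * x) ^+ #|S|.
Proof.
move=> x_ge0 injS.
pose rho (a : {ffun G -> F}) : {ffun G -> F} := [ffun z => if z \in S then a z else 0].
have rho_inj : {in I &, injective rho}.
  move=> a b Ia Ib /ffunP ab; apply: injS => // z zS.
  by have := ab z; rewrite !ffunE zS.
have rhoE a : #|supp a :&: S| = #|supp (rho a) :&: S|.
  by apply: eq_card => z; rewrite !inE ffunE; case: (z \in S); rewrite ?andbF.
under eq_bigr do rewrite rhoE.
rewrite -(big_imset (fun a => x ^+ #|supp a :&: S|) rho_inj) /= -sum_supp_pffun.
rewrite big_mkcond [leRHS]big_mkcond /=; apply: ler_sum => f _.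
case: imsetP => [[a _ ->]|_]; last by case: ifP => // _; rewrite exprn_ge0.
rewrite ifT //; apply/pfamilyP; split=> //; apply/subsetP=> z.
by rewrite inE /= ffunE; case: ifP => //; rewrite eqxx.
Qed.

(** [S] is chosen minimal among the sets on which no nonzero word of [I] vanishes identically. Its
    size is the dimension of [I]. *)
Lemma exists_information_set (F : finFieldType) (G : finType)
    (I : {set {ffun G -> F}}) :
  is_linear_code I ->
  exists2 S : {set G}, information_set I S & #|I| = (#|F| ^ #|S|)%N.
Proof.
move=> [I0 ID IZ].
have IN a : a \in I -> - a \in I.
  by move=> /(IZ (-1)); congr (_ \in I); apply/ffunP => z; rewrite !ffunE mulN1r.
pose P (S : {set G}) := [forall a in I, [forall z in S, a z == 0] ==> (a == 0)].
have [S /minsetP[PS minS]] : {S | minset P S}.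
  apply: ex_minset; exists [set: G]; apply/forall_inP => a Ia; apply/implyP => /forall_inP a0.
  by apply/eqP/ffunP => z; rewrite ffunE; apply/eqP/a0; rewrite inE.
have injS : information_set I S.
  move=> a b Ia Ib ab; apply/eqP; rewrite -subr_eq0.
  apply: (implyP (forall_inP PS _ _)); first by rewrite ID // IN.
  by apply/forall_inP => z zS; rewrite !ffunE ab // subrr.
exists S => //.
(* By minimality of S, some codeword vanishes on S except at s; after scaling,
   these are dual to the points of S, whence every word on S is attained. *)
have dual s : exists e : {ffun G -> F}, s \in S ->
    e \in I /\ {in S, forall z, e z = (z == s)%:R}.
  have [sS|nsS] := boolP (s \in S); last by exists 0.
  have /forall_inPn[a Ia] : ~~ P (S :\ s).
    apply/negP => /minS /(_ (subD1set _ _)) SE.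
    by move: sS; rewrite -SE !inE eqxx.
  rewrite negb_imply => /andP[/forall_inP a0 aN0].
  have as0 : a s != 0.
    apply: contra aN0 => as0; apply: (implyP (forall_inP PS _ Ia)).
    apply/forall_inP => z zS; have [->//|zs] := eqVneq z s.
    by apply: a0; rewrite !inE zs.
  exists [ffun z => (a s)^-1 * a z] => _; split; first exact: IZ.
  move=> z zS; rewrite ffunE; have [->|zs] := eqVneq z s; first by rewrite mulVf.
  by rewrite (eqP (a0 z _)) ?mulr0 // !inE zs.
have [e eP] := fin_all_exists dual.
pose rho (a : {ffun G -> F}) : {ffun G -> F} := [ffun z => if z \in S then a z else 0].
have rho_inj : {in I &, injective rho}.
  move=> a b Ia Ib /ffunP ab; apply: injS => // z zS.
  by have := ab z; rewrite !ffunE zS.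
rewrite -(card_in_imset rho_inj) -(card_pffun_on 0 (mem S) (predT : pred F)).
apply: eq_card => f; apply/imsetP/pfamilyP => [[a _ ->]|[fS _]].
  split=> //; apply/subsetP=> z.
  by rewrite inE /= ffunE; case: ifP => //; rewrite eqxx.
exists (\sum_(s in S) [ffun z => f s * e s z]).
  apply: (big_ind (fun a => a \in I)) => // s sS.
  by apply: IZ; have [] := eP s sS.
apply/ffunP => z; rewrite ffunE; case: ifPn => zS; last first.
  by apply/eqP; apply: contraNT zS => fz; apply: (subsetP fS).
rewrite sum_ffunE (bigD1 z) //= ffunE (eP z zS).2 // eqxx mulr1 big1 ?addr0 //.
by move=> s /andP[sS sz]; rewrite ffunE (eP s sS).2 // eq_sym (negbTE sz) mulr0.
Qed.

(* Jensen's inequality over the translates of an information set: on average,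
   a translate meets the support in a fraction |S| / |G| of its points. *)
Lemma sum_weight_group_code_le (R : realType) (F : finFieldType) (G : finZmodType)
    (I : {set {ffun G -> F}}) (S : {set G}) (t : R) :
  (forall x a, a \in I -> shift x a \in I) -> information_set I S ->
  \sum_(a in I) expR (- (t * (#|supp a| * #|S|)%:R / #|G|%:R)) <=
  (1 + (#|F|%:R - 1) * expR (- t)) ^+ #|S|.
Proof.
move=> Ishift injS.
have G_gt0 : (0 < #|G|)%N by apply/card_gt0P; exists 0.
have shiftK x : cancel (@shift F G x) (shift (- x)).
  by move=> a; apply/ffunP => z; rewrite !ffunE subrK.
pose e x (a : {ffun G -> F}) := #|supp (shift x a) :&: S|.
have sum_e a : (\sum_x e x a = #|supp a| * #|S|)%N.
  have eE x : e x a = (\sum_(z in S) (a (z + x)%R != 0%R))%N.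
    rewrite /e -sum1_card (eq_bigl (fun z => (z \in S) && (a (z + x) != 0))).
      by rewrite big_mkcondr; apply: eq_bigr => z _; case: (_ != _).
    by move=> z; rewrite !inE ffunE andbC.
  under eq_bigr do rewrite eE.
  rewrite exchange_big /= mulnC -sum_nat_const; apply: eq_bigr => z _.
  rewrite -sum1_card (reindex_inj (@addrI _ (- z))) /= [RHS]big_mkcond /=.
  by apply: eq_bigr => x _; rewrite addrA subrr add0r inE; case: (_ != _).
apply: (@le_trans _ _ (\sum_(a in I) (\sum_x expR (- t) ^+ e x a) / #|G|%:R)).
  apply: ler_sum => a _; rewrite -sum_e natr_sum mulr_sumr -mulNr -sumrN.
  under [X in _ <= X / _]eq_bigr do rewrite -expRM_natr mulNr.
  exact: expR_sum_jensen.
rewrite -mulr_suml exchange_big /= ler_pdivrMr ?ltr0n // mulr_natr -sumr_const.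
apply: ler_sum => x _.
apply: le_trans (sum_supp_information_set_le (expR_ge0 (- t)) injS).
rewrite [leRHS](reindex_inj (can_inj (shiftK x))) /=.
rewrite (eq_bigl (fun a => shift x a \in I)) // => a.
by apply/idP/idP => [/Ishift //|/(Ishift (- x))]; rewrite shiftK.
Qed.

(** Chernoff bound: for each light word the product of the [W (c j)] is at least e^(-t delta |S| n),
    and these products sum over I^n to the n-th power of the sum of [W] over [I]. *)
Lemma card_light_words_le (R : realType) (F : finFieldType) (G : finZmodType) (n : nat)
    (I : {set {ffun G -> F}}) (S : {set G}) (t delta : R) :
  (forall x a, a \in I -> shift x a \in I) -> information_set I S -> 0 <= t ->
  #|[set c : {ffun 'I_n -> {ffun G -> F}} |
      (c \in ffun_on (mem I)) && ((hweight c)%:R <= delta * (#|G| * n)%:R)]|%:R <=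
  (expR (t * delta) * (1 + (#|F|%:R - 1) * expR (- t))) ^+ (#|S| * n).
Proof.
move=> Ishift injS t_ge0.
have G_gt0 : 0 < #|G|%:R :> R by rewrite ltr0n; apply/card_gt0P; exists 0.
set L := [set c | _].
pose W (a : {ffun G -> F}) : R := expR (- (t * (#|supp a| * #|S|)%:R / #|G|%:R)).
rewrite exprMn -expRM_natr -ler_pdivrMl ?expR_gt0 // -expRN.
apply: (@le_trans _ _ (\sum_(c in ffun_on (mem I)) \prod_(j < n) W (c j))); last first.
  rewrite -(bigA_distr_big (mem I) (fun (j : 'I_n) a => W a)) /=.
  rewrite prodr_const card_ord exprM; apply: lerXn2r.
  - by rewrite nnegrE sumr_ge0 // => a _; exact: expR_ge0.
  - by rewrite nnegrE exprn_ge0 // addr_ge0 // mulr_ge0 ?expR_ge0 // subr_ge0 ler1n;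
       apply/card_gt0P; exists 0.
  - exact: sum_weight_group_code_le.
rewrite [leLHS]mulr_natr -sumr_const big_mkcond [leRHS]big_mkcond /=; apply: ler_sum => c _.
rewrite inE; case: (c \in _) => //=; case: ifP => [cL|_]; last first.
  by apply: prodr_ge0 => j _; exact: expR_ge0.
rewrite -expR_sum ler_expR sumrN lerN2 -mulr_suml -mulr_sumr ler_pdivrMr //.
have -> : \sum_(j < n) (#|supp (c j)| * #|S|)%:R = (hweight c * #|S|)%:R :> R.
  by rewrite -natr_sum -big_distrl.
rewrite -[_ * _ * #|G|%:R]mulrA -mulrA ler_wpM2l // !natrM.
rewrite natrM in cL; have := ler_wpM2r (ler0n R #|S|) cL.
by congr (_ <= _); ring.
Qed.

(** * Entropy and the Chernoff parameter *)

Lemma ln_hq (R : realType) (q : nat) (delta : R) :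
  (1 < q)%N -> 0 < delta < 1 ->
  ln q%:R * hq q delta =
  delta * ln (q%:R - 1) - delta * ln delta - (1 - delta) * ln (1 - delta).
Proof.
move=> q_gt1 /andP[d0 d1]; rewrite /hq /xlogq gt_eqF // subr_eq0 (gt_eqF d1).
have lnq : ln (q%:R : R) != 0 by rewrite gt_eqF // ln_gt0 // ltr1n.
by field.
Qed.

(* At the parameter t with e^-t = delta / ((1 - delta) (q - 1)), the Chernoff bound
   on the number of words of relative weight at most delta equals q^(h_q(delta)). *)
Lemma entropy_tilt (R : realType) (q : nat) (delta : R) :
  (1 < q)%N -> 0 < delta < 1 - q%:R^-1 ->
  exists2 t : R, 0 <= t &
    expR (t * delta) * (1 + (q%:R - 1) * expR (- t)) = expR (ln q%:R * hq q delta).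
Proof.
move=> q_gt1 /andP[d0 d1].
have q0 : 0 < q%:R :> R by rewrite ltr0n ltnW.
have q1 : 0 < q%:R - 1 :> R by rewrite subr_gt0 ltr1n.
have qV : 0 < q%:R^-1 :> R by rewrite invr_gt0.
have d1' : 0 < 1 - delta by lra.
have dq : 1 < (1 - delta) * q%:R by rewrite -ltr_pdivrMr // mul1r; lra.
have y0 : 0 < (1 - delta) * (q%:R - 1) / delta by rewrite divr_gt0 ?mulr_gt0.
exists (ln ((1 - delta) * (q%:R - 1) / delta)).
  (* The bound delta < 1 - 1/q gives (1 - delta) (q - 1) >= delta, whence t >= 0. *)
  by apply: ln_ge0; rewrite ler_pdivlMr // mul1r; nra.
rewrite expRN lnK ?posrE //.
have -> : 1 + (q%:R - 1) * ((1 - delta) * (q%:R - 1) / delta)^-1 = expR (- ln (1 - delta)).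
  by rewrite expRN lnK ?posrE //; field; rewrite !gt_eqF.
rewrite -expRD ln_hq //; last by rewrite d0; lra.
rewrite ln_div ?posrE ?mulr_gt0 // lnM ?posrE //.
by congr expR; ring.
Qed.

(** * Ideals of the group algebra and uniform codewords *)

Lemma gmulDr (F : finFieldType) (G : finZmodType) (a b c : {ffun G -> F}) :
  gmul a (b + c) = gmul a b + gmul a c.
Proof.
apply/ffunP => z; rewrite !ffunE -big_split /=.
by apply: eq_bigr => x _; rewrite ffunE mulrDr.
Qed.

Lemma gmul0r (F : finFieldType) (G : finZmodType) (a : {ffun G -> F}) : gmul a 0 = 0.
Proof. by apply/ffunP => z; rewrite !ffunE big1 // => x _; rewrite ffunE mulr0. Qed.

Lemma gmulZr (F : finFieldType) (G : finZmodType) (t : F) (a b : {ffun G -> F}) :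
  gmul a [ffun z => t * b z] = [ffun z => t * gmul a b z].
Proof.
apply/ffunP => z; rewrite !ffunE mulr_sumr.
by apply: eq_bigr => x _; rewrite ffunE mulrCA.
Qed.

Lemma gmul_shift (F : finFieldType) (G : finZmodType) (x : G) (a b : {ffun G -> F}) :
  gmul a (shift x b) = shift x (gmul a b).
Proof.
by apply/ffunP => z; rewrite !ffunE; apply: eq_bigr => y _; rewrite ffunE addrAC.
Qed.

Lemma gmul1r (F : finFieldType) (G : finZmodType) (a : {ffun G -> F}) :
  gmul a [ffun z => (z == 0)%:R] = a.
Proof.
apply/ffunP => z; rewrite ffunE (bigD1 z) //= ffunE subrr eqxx mulr1.
by rewrite big1 ?addr0 // => x xz; rewrite ffunE subr_eq0 eq_sym (negbTE xz) mulr0.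
Qed.

Lemma codewordE (F : finFieldType) (G : finZmodType) (k n : nat)
    (b : {ffun 'I_k -> {ffun G -> F}}) (A : 'M[{ffun G -> F}]_(k, n)) (j : 'I_n) :
  codeword b A j = \sum_i gmul (b i) (A i j).
Proof. by apply/ffunP => z; rewrite !ffunE sum_ffunE. Qed.

Lemma codewordD (F : finFieldType) (G : finZmodType) (k n : nat)
    (b : {ffun 'I_k -> {ffun G -> F}}) (A B : 'M[{ffun G -> F}]_(k, n)) :
  codeword b (A + B) = codeword b A + codeword b B.
Proof.
apply/ffunP => j; rewrite [RHS]ffunE !codewordE -big_split /=.
by apply: eq_bigr => i _; rewrite mxE gmulDr.
Qed.

Definition ideal_of (F : finFieldType) (G : finZmodType) (k : nat)
    (b : {ffun 'I_k -> {ffun G -> F}}) : {set {ffun G -> F}} :=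
  [set \sum_i gmul (b i) (c i) | c : {ffun 'I_k -> {ffun G -> F}}].

Lemma ideal_of_linear (F : finFieldType) (G : finZmodType) (k : nat)
    (b : {ffun 'I_k -> {ffun G -> F}}) : is_linear_code (ideal_of b).
Proof.
split.
- apply/imsetP; exists 0 => //.
  by rewrite big1 // => i _; rewrite ffunE gmul0r.
- move=> _ _ /imsetP[c _ ->] /imsetP[c' _ ->]; apply/imsetP; exists (c + c') => //.
  by rewrite -big_split /=; apply: eq_bigr => i _; rewrite ffunE gmulDr.
- move=> t _ /imsetP[c _ ->]; apply/imsetP; exists [ffun i => [ffun z => t * c i z]] => //.
  apply/ffunP => z; rewrite ffunE !sum_ffunE mulr_sumr.
  apply: eq_bigr => i _; have -> : [ffun i => [ffun z => t * c i z]] i =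
    [ffun z => t * c i z] by rewrite ffunE.
  by rewrite gmulZr [RHS]ffunE.
Qed.

Lemma ideal_of_shift (F : finFieldType) (G : finZmodType) (k : nat)
    (b : {ffun 'I_k -> {ffun G -> F}}) (x : G) (a : {ffun G -> F}) :
  a \in ideal_of b -> shift x a \in ideal_of b.
Proof.
move=> /imsetP[c _ ->]; apply/imsetP; exists [ffun i => shift x (c i)] => //.
apply/ffunP => z; rewrite ffunE !sum_ffunE; apply: eq_bigr => i _.
have -> : [ffun i => shift x (c i)] i = shift x (c i) by rewrite ffunE.
by rewrite gmul_shift [RHS]ffunE.
Qed.

(** The unit of FG serves as coefficient at [i]. It follows that at most |I|^k vectors generate an
    ideal I. *)
Lemma mem_ideal_of (F : finFieldType) (G : finZmodType) (k : nat)
    (b : {ffun 'I_k -> {ffun G -> F}}) (i : 'I_k) : b i \in ideal_of b.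
Proof.
apply/imsetP; exists [ffun j => if j == i then [ffun z => (z == 0)%:R] else 0] => //.
rewrite (bigD1 i) //= ffunE eqxx gmul1r big1 ?addr0 // => j /negbTE ji.
by rewrite ffunE ji gmul0r.
Qed.

(** The j-th entry of b A involves only the j-th column of [A], so the entries range over the ideal
    independently. *)
Lemma codeword_image (F : finFieldType) (G : finZmodType) (k n : nat)
    (b : {ffun 'I_k -> {ffun G -> F}}) (c : {ffun 'I_n -> {ffun G -> F}}) :
  (c \in codeword b @: [set: 'M[{ffun G -> F}]_(k, n)]) =
  (c \in ffun_on (mem (ideal_of b))).
Proof.
apply/imsetP/ffun_onP => [[A _ ->] j|cI].
  rewrite codewordE; apply/imsetP; exists [ffun i => A i j] => //.
  by apply: eq_bigr => i _; rewrite ffunE.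
have pre j : exists v : {ffun 'I_k -> {ffun G -> F}}, c j = \sum_i gmul (b i) (v i).
  by have /imsetP[v _ ->] := cI j; exists v.
have [v vE] := fin_all_exists pre.
exists (\matrix_(i, j) v j i) => //; apply/ffunP => j.
by rewrite codewordE vE; apply: eq_bigr => i _; rewrite mxE.
Qed.

(* The random codeword b A is uniform on the n-th power of the ideal of b. *)
Lemma card_codeword_preim (F : finFieldType) (G : finZmodType) (k n : nat)
    (b : {ffun 'I_k -> {ffun G -> F}}) (L : {set {ffun 'I_n -> {ffun G -> F}}}) :
  (#|[set A : 'M[{ffun G -> F}]_(k, n) | codeword b A \in L]| * #|ideal_of b| ^ n =
   #|[set c in L | c \in ffun_on (mem (ideal_of b))]| *
   #|{: 'M[{ffun G -> F}]_(k, n)}|)%N.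
Proof.
have := @card_preimset_homogeneous _ _ (@codeword F G k n b) L.
have -> : #|codeword b @: [set: 'M[{ffun G -> F}]_(k, n)]| = (#|ideal_of b| ^ n)%N.
  by rewrite (eq_card (codeword_image b)) card_ffun_on card_ord.
have -> : #|L :&: codeword b @: [set: 'M[{ffun G -> F}]_(k, n)]| =
    #|[set c in L | c \in ffun_on (mem (ideal_of b))]|.
  by apply: eq_card => c; rewrite finset.in_setI codeword_image inE.
apply=> A1 A2; exists (fun A => A + (A2 - A1)); first exact: addIr.
by move=> A AE; rewrite codewordD AE -codewordD addrC subrK.
Qed.

(** * Below the GV bound: the first moment *)

Definition light_words (R : realType) (F : finFieldType) (G : finZmodType) (n : nat)
    (delta : R) : {set {ffun 'I_n -> {ffun G -> F}}} :=
  [set c | nonzero_word c && ((hweight c)%:R <= delta * (#|G| * n)%:R)].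

(** By uniformity the probability is the proportion of light words in I^n, at most q^(d n h) / q^(d
    n) with h = h_q(delta) and [d] the dimension of I. The factor [(0 < d)%N%:R] records that the
    zero ideal has no light word. *)
Lemma prob_light_codeword_le (R : realType) (F : finFieldType) (G : finZmodType)
    (k n : nat) (delta : R) (b : {ffun 'I_k -> {ffun G -> F}}) :
  0 < delta < 1 - #|F|%:R^-1 ->
  exists d : nat, [/\ #|ideal_of b| = (#|F| ^ d)%N, (d <= #|G|)%N &
    #|[set A : 'M[{ffun G -> F}]_(k, n) | codeword b A \in light_words F G n delta]|%:R <=
    (0 < d)%N%:R * expR (- (d%:R * n%:R * (ln #|F|%:R * gq #|F| delta))) *
    #|{: 'M[{ffun G -> F}]_(k, n)}|%:R].
Proof.
move=> d01; have q1 := card_finNzRing_gt1 F.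
have q0 : 0 < #|F|%:R :> R by rewrite ltr0n ltnW.
have [S injS cardI] := exists_information_set (ideal_of_linear b).
exists #|S|; split=> //; first exact: max_card.
set L := light_words _ _ _ _; set X := (X in X <= _); set M := (X in _ <= _ * X).
have cI : #|ideal_of b|%:R = expR (#|S|%:R * ln #|F|%:R) :> R.
  by rewrite cardI natrX expRM_natl lnK ?posrE.
have XE : X * expR (#|S|%:R * n%:R * ln #|F|%:R) =
    #|[set c in L | c \in ffun_on (mem (ideal_of b))]|%:R * M.
  rewrite -[RHS]natrM -card_codeword_preim natrM natrX cI -expRM_natl; congr (_ * expR _).
  by ring.
have [S0|S_gt0] := posnP #|S|.
  suff -> : X = 0 by rewrite !mul0r.
  have /eqP := cardI; rewrite S0 expn0 => /cards1P[a aE].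
  have [I0 _ _] := ideal_of_linear b.
  rewrite /X (eq_card0 _) // => A; rewrite !inE; apply/negP => /andP[/existsP[j /existsP[z]]].
  have : codeword b A \in codeword b @: [set: 'M[{ffun G -> F}]_(k, n)].
    by apply: imset_f; rewrite inE.
  rewrite codeword_image => /ffun_onP /(_ j).
  move: I0; rewrite aE !inE => /eqP <- /eqP ->.
  by rewrite ffunE eqxx.
have [t t0 tE] := entropy_tilt q1 d01.
have cL : #|[set c in L | c \in ffun_on (mem (ideal_of b))]|%:R <=
    expR (#|S|%:R * n%:R * (ln #|F|%:R * hq #|F| delta)).
  have := card_light_words_le n delta (@ideal_of_shift F G k b) injS t0.
  rewrite tE -expRM_natl [in leRHS]natrM; apply: le_trans; rewrite ler_nat; apply: subset_leq_card.
  by apply/subsetP => c; rewrite !inE => /andP[/andP[_ ->] ->].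
rewrite mul1r -(ler_pM2r (expR_gt0 (#|S|%:R * n%:R * ln #|F|%:R))) XE.
have -> : expR (- (#|S|%:R * n%:R * (ln #|F|%:R * gq #|F| delta))) * M *
     expR (#|S|%:R * n%:R * ln #|F|%:R) =
     expR (#|S|%:R * n%:R * (ln #|F|%:R * hq #|F| delta)) * M.
  by rewrite mulrAC -expRD /gq; congr (expR _ * _); ring.
by rewrite ler_wpM2r // ler0n.
Qed.

(** If C_A = {0}, [minwt] takes its default |G| n, of relative value 1; [delta < 1] covers that
    case. *)
Lemma relDist_gt (R : realType) (F : finFieldType) (G : finZmodType) (k n : nat)
    (delta : R) (A : 'M[{ffun G -> F}]_(k, n)) :
  (0 < n)%N -> delta < 1 ->
  (forall b, codeword b A \notin light_words F G n delta) -> delta < relDist R A.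
Proof.
move=> n_gt0 d1 noL.
have mn_gt0 : 0 < (#|G| * n)%:R :> R.
  by rewrite ltr0n muln_gt0 n_gt0 andbT; apply/card_gt0P; exists 0.
rewrite /relDist ltr_pdivlMr // /minwt.
apply: (big_ind (fun w : nat => delta * (#|G| * n)%:R < w%:R)).
- by rewrite gtr_pMl.
- by move=> x y x_gt y_gt; rewrite /minn; case: ifP.
- by move=> b nz; have := noL b; rewrite inE nz /= -ltNge.
Qed.

Lemma nearest_k_bounds (R : realType) (r : R) (n : nat) : 0 < r ->
  r * n%:R - 2^-1 < (nearest_k r n)%:R <= r * n%:R + 2^-1.
Proof.
move=> r_gt0; have rn_ge0 : 0 <= r * n%:R by rewrite mulr_ge0 ?ler0n // ltW.
have x_ge0 : 0 <= r * n%:R + 2^-1 :> R by lra.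
have := truncn_itv x_ge0; rewrite -/(nearest_k r n) -[X in _ < X]natr1.
by case/andP=> le_k lt_k; rewrite le_k andbT; lra.
Qed.

(** At most q^(d k) vectors generate [I], each giving a light codeword with probability at most
    q^(-d n g), where g = g_q(delta). As d <= |G|, and d >= 1 unless [I] is zero, the product is
    bounded uniformly in d. *)
Lemma sum_prob_light_le (R : realType) (F : finFieldType) (G : finZmodType)
    (k n : nat) (r delta : R) (I : {set {ffun G -> F}}) :
  k%:R <= r * n%:R + 2^-1 -> 0 < delta < 1 - #|F|%:R^-1 -> r < gq #|F| delta ->
  \sum_(b : {ffun 'I_k -> {ffun G -> F}} | ideal_of b == I)
    #|[set A : 'M[{ffun G -> F}]_(k, n) |
        codeword b A \in light_words F G n delta]|%:R <=
  expR (#|G|%:R * ln #|F|%:R) *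
  expR (- (ln #|F|%:R * (gq #|F| delta - r) * n%:R)) *
  #|{: 'M[{ffun G -> F}]_(k, n)}|%:R.
Proof.
move=> k_le d01 r_lt.
have q1 := card_finNzRing_gt1 F.
have q0 : 0 < #|F|%:R :> R by rewrite ltr0n ltnW.
have L0 : 0 < ln (#|F|%:R : R) by rewrite ln_gt0 // ltr1n.
have [b0 /eqP b0I|noI] := pickP [pred b : {ffun 'I_k -> {ffun G -> F}} | ideal_of b == I];
  last by rewrite big_pred0 // !mulr_ge0 ?expR_ge0 ?ler0n.
have [d [cI dG _]] := prob_light_codeword_le n b0 d01.
set M := (X in _ <= _ * X).
set e := (0 < d)%N%:R * expR (- (d%:R * n%:R * (ln #|F|%:R * gq #|F| delta))).
apply: (@le_trans _ _ (\sum_(b : {ffun 'I_k -> {ffun G -> F}} | ideal_of b == I) e * M)).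
  (* The dimension depends only on [I], since q^d = |I|. *)
  apply: ler_sum => b /eqP bI; have [d' [cI' _]] := prob_light_codeword_le n b d01.
  suff -> : d' = d by [].
  by apply/eqP; rewrite -(eqn_exp2l _ _ q1) -cI -cI' bI b0I.
have e_ge0 : 0 <= e by rewrite mulr_ge0 ?expR_ge0.
rewrite sumr_const -[_ *+ _]mulr_natl mulrA ler_wpM2r ?ler0n //.
apply: (@le_trans _ _ ((#|I| ^ k)%:R * e)).
  rewrite ler_wpM2r // ler_nat -[k in (_ ^ k)%N]card_ord -card_ffun_on.
  apply: subset_leq_card; apply/subsetP => b; rewrite -[_ \in _]/(ideal_of b == I).
  move=> /eqP <-.
  by apply/ffun_onP => i; exact: mem_ideal_of.
have -> : (#|I| ^ k)%:R = expR (d%:R * k%:R * ln #|F|%:R) :> R.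
  rewrite -b0I cI -expnM natrX -{1}[#|F|%:R]lnK ?posrE // -expRM_natl natrM.
  by congr expR; ring.
(* The factor vanishing at d = 0 matters here: the zero ideal would otherwise contribute 1, which
   does not decay. *)
rewrite /e; case: posnP => [_|d_gt0]; first by rewrite mul0r mulr0 mulr_ge0 ?expR_ge0.
rewrite mul1r -!expRD ler_expR.
have d1 : 1 <= d%:R :> R by rewrite ler1n.
have dG' : d%:R <= #|G|%:R :> R by rewrite ler_nat.
have n0 : 0 <= n%:R :> R by rewrite ler0n.
rewrite -mulNr [leLHS](_ : _ = ln #|F|%:R * (d%:R * (k%:R - n%:R * gq #|F| delta))); last by ring.
rewrite [leRHS](_ : _ = ln #|F|%:R * (#|G|%:R - (gq #|F| delta - r) * n%:R)); last by ring.
rewrite ler_pM2l //; set s := (_ - r) * n%:R.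
have s_ge0 : 0 <= s by rewrite mulr_ge0 // subr_ge0 ltW.
(* Rounding adds at most 1/2 to [k]; multiplied by [d] this stays below |G|, while d s >= s. *)
have le_s : k%:R - n%:R * gq #|F| delta <= 2^-1 - s by rewrite /s; lra.
have := ler_wpM2l (ler0n R d) le_s.
have : 0 <= (d%:R - 1) * s by rewrite mulr_ge0 // subr_ge0.
by lra.
Qed.

(** Union bound over all b, grouped by the ideal they generate. The number of ideals is bounded by
    the number of subsets of FG, a constant in [n]. *)
Lemma prob_dist_gt_lower (R : realType) (F : finFieldType) (G : finZmodType)
    (n : nat) (r delta : R) :
  (0 < n)%N -> 0 < r -> 0 < delta < 1 - #|F|%:R^-1 -> r < gq #|F| delta ->
  `|prob_dist_gt F G (nearest_k r n) n delta - 1| <=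
  #|{set {ffun G -> F}}|%:R * expR (#|G|%:R * ln #|F|%:R) *
  expR (- (ln #|F|%:R * (gq #|F| delta - r) * n%:R)).
Proof.
move=> n_gt0 r_gt0 d01 r_lt; set k := nearest_k r n.
have d1 : delta < 1.
  have q0 : 0 <= #|F|%:R^-1 :> R by rewrite invr_ge0.
  by case/andP: d01; lra.
rewrite /prob_dist_gt; set good := [set A | _]; set M := (X in _ / X).
have M_gt0 : 0 < M by rewrite ltr0n; apply/card_gt0P; exists 0.
have -> : #|good|%:R / M - 1 = - (#|~: good|%:R / M).
  have : #|good|%:R + #|~: good|%:R = M by rewrite -natrD cardsC.
  by move=> <-; field; rewrite -natrD cardsC gt_eqF.
rewrite normrN ger0_norm ?divr_ge0 ?ler0n ?(ltW M_gt0) // ler_pdivrMr //.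
apply: (@le_trans _ _ (\sum_(b : {ffun 'I_k -> {ffun G -> F}})
    #|[set A : 'M[{ffun G -> F}]_(k, n) |
        codeword b A \in light_words F G n delta]|%:R)).
  under eq_bigr do rewrite natr_card.
  rewrite exchange_big natr_card; apply: ler_sum => A _ /=.
  rewrite -natr_sum ler_nat.
  case: (boolP (A \in ~: good)) => //; rewrite !inE => nA.
  have [b Ab|noL] := pickP (fun b => codeword b A \in light_words F G n delta).
    by rewrite (bigD1 b) //= [A \in _]inE Ab.
  by case/negP: nA; apply: relDist_gt => // b; rewrite noL.
rewrite (partition_big (@ideal_of F G k) predT) //=.
apply: (@le_trans _ _ (\sum_(I : {set {ffun G -> F}})
  expR (#|G|%:R * ln #|F|%:R) *
  expR (- (ln #|F|%:R * (gq #|F| delta - r) * n%:R)) * M)).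
  apply: ler_sum => I _; apply: sum_prob_light_le => //.
  by have /andP[] := nearest_k_bounds n r_gt0.
by rewrite sumr_const -[_ *+ _]mulr_natl !mulrA.
Qed.

(** * Words of a given weight *)

Definition binomial_term (R : pzRingType) (delta : R) (n i : nat) : R :=
  'C(n, i)%:R * delta ^+ i * (1 - delta) ^+ (n - i).

(* The terms increase up to index j and decrease from j + 1 on, and the step from j to
   j + 1 multiplies them by at most 1 / (1 - delta). *)
Lemma binomial_term_ge (R : realFieldType) (delta : R) (n j : nat) :
  0 < delta < 1 -> j%:R <= delta * n%:R < j.+1%:R ->
  (1 - delta) / n.+1%:R <= binomial_term delta n j.
Proof.
move=> /andP[d0 d1] /andP[j_le j_gt]; pose t := binomial_term delta n.
have e0 : 0 < 1 - delta by lra.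
have t_ge0 i : 0 <= t i by rewrite !mulr_ge0 ?exprn_ge0 ?ler0n ?ltW.
have t_rec i : (i < n)%N -> i.+1%:R * (1 - delta) * t i.+1 = (n%:R - i%:R) * delta * t i.
  move=> lt_in; rewrite /t /binomial_term -natrB 1?ltnW //.
  have /(congr1 (fun x : nat => x%:R : R)) := mul_bin_left n i.
  rewrite !natrM => binE.
  have -> : (n - i = (n - i.+1).+1)%N by rewrite subnS prednK // subn_gt0.
  rewrite !exprS; set x := delta ^+ i; set y := (1 - delta) ^+ _.
  rewrite (_ : (n - i.+1).+1 = n - i)%N; last by rewrite subnS prednK // subn_gt0.
  transitivity (i.+1%:R * 'C(n, i.+1)%:R * ((1 - delta) * delta * x * y)); first by ring.
  by rewrite binE; ring.
have t_out i : (n < i)%N -> t i = 0 by move=> ?; rewrite /t /binomial_term bin_small // !mul0r.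
have incr i : (i < j)%N -> t i <= t i.+1.
  move=> lt_ij; have le_ij : i.+1%:R <= j%:R :> R by rewrite ler_nat.
  have lt_in : (i < n)%N.
    rewrite -(ltr_nat R) (lt_le_trans (y := j%:R)) ?ltr_nat // (le_trans j_le) //.
    by rewrite ger_pMl ?ltW // ltr0n; case: (n) lt_ij j_le => // lt_ij;
       rewrite mulr0 lern0 => /eqP j0; rewrite j0 in lt_ij.
  have c0 : 0 < i.+1%:R * (1 - delta) by rewrite mulr_gt0 ?ltr0n.
  rewrite -(ler_pM2l c0) t_rec // ler_wpM2r // -natr1; rewrite -natr1 in le_ij.
  by have := j_le; nra.
have decr i : (j < i)%N -> t i.+1 <= t i.
  move=> lt_ji; have [lt_in|le_ni] := ltnP i n; last by rewrite t_out.
  have le_ji : j.+1%:R <= i%:R :> R by rewrite ler_nat.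
  have c0 : 0 < i.+1%:R * (1 - delta) by rewrite mulr_gt0 ?ltr0n.
  rewrite -(ler_pM2l c0) t_rec // ler_wpM2r // -natr1.
  by have := j_gt; nra.
have step : (1 - delta) * t j.+1 <= t j.
  have [lt_jn|le_nj] := ltnP j n; last by rewrite t_out // mulr0.
  have c0 : 0 < j.+1%:R :> R by rewrite ltr0n.
  rewrite -(ler_pM2l c0) mulrA t_rec // ler_wpM2r //.
  by have := ler0n R j; have := j_gt; nra.
have le_tj i : (1 - delta) * t i <= t j.
  have [le_ij|lt_ji] := leqP i j.
    have le_t l : (i <= l <= j)%N -> t i <= t l.
      elim: l => [|l IHl]; first by rewrite andbT leqn0 => /eqP ->.
      rewrite leq_eqVlt => /andP[/orP[/eqP->//|le_il] lt_lj].
      by rewrite (le_trans (IHl _)) ?incr // -ltnS le_il ltnW.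
    apply: (@le_trans _ _ (t i)); last by rewrite le_t ?le_ij /=.
    by rewrite ler_piMl //; lra.
  apply: le_trans step; rewrite ler_pM2l //.
  elim: i lt_ji => // i IHi; rewrite ltnS leq_eqVlt => /orP[/eqP->//|lt_ji].
  exact: le_trans (decr i lt_ji) (IHi lt_ji).
(* The n + 1 terms sum to 1 and each is at most t j / (1 - delta). *)
have sum_t : \sum_(i < n.+1) t i = 1.
  have := exprDn (1 - delta) delta n; rewrite subrK expr1n => ->.
  by apply: eq_bigr => i _; rewrite /t /binomial_term -mulr_natl; ring.
rewrite ler_pdivrMr ?ltr0n // -[leLHS]mulr1 -[X in _ * X <= _]sum_t mulr_sumr.
apply: (@le_trans _ _ (\sum_(i < n.+1) t j)); first by apply: ler_sum.
by rewrite sumr_const card_ord -[_ *+ _]mulr_natr.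
Qed.

Lemma card_weight (F : finFieldType) (G : finType) (j : nat) :
  #|[set f : {ffun G -> F} | #|supp f| == j]| = ('C(#|G|, j) * #|F|.-1 ^ j)%N.
Proof.
rewrite -sum1_card (partition_big (@supp F G) (mem [set S : {set G} | #|S| == j])) /=; last first.
  by move=> f; rewrite !inE.
rewrite -card_draws -sum_nat_const; apply: eq_bigr => S; rewrite inE => /eqP cS.
rewrite -cS -(cardC1 (0 : F)) -(card_pffun_on 0 (mem S)) sum1dep_card.
apply: eq_card => f; apply/idP/pfamilyP => [|[fS fN0]]; rewrite !inE.
  case/andP=> _ /eqP <-.
  by split=> [|z]; [apply/subsetP => z; rewrite !inE | rewrite !inE].
suff -> : supp f = S by rewrite cS !eqxx.
apply/setP => z; rewrite inE; apply/idP/idP => [fz|/fN0]; last by rewrite !inE.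
by apply: (subsetP fS).
Qed.

(** After the binomial term is split off, the exponent is affine in the weight j, with slope [t] >=
    0 and value n ln q h_q(delta) at j = delta n. Rounding delta n down thus costs at most [t]. *)
Lemma card_weight_entropy_ge (R : realType) (q : nat) (delta : R) :
  (1 < q)%N -> 0 < delta < 1 - q%:R^-1 ->
  exists2 K : R, 0 < K & forall n,
    K / n.+1%:R * expR (n%:R * (ln q%:R * hq q delta)) <=
    ('C(n, Num.truncn (delta * n%:R)) * q.-1 ^ Num.truncn (delta * n%:R))%:R.
Proof.
move=> q_gt1 /andP[d0 d1].
have q0 : 0 < q%:R :> R by rewrite ltr0n ltnW.
have q1 : 0 < q%:R - 1 :> R by rewrite subr_gt0 ltr1n.
have qV : 0 < q%:R^-1 :> R by rewrite invr_gt0.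
have e0 : 0 < 1 - delta by lra.
have dq : 1 < (1 - delta) * q%:R by rewrite -ltr_pdivrMr // mul1r; lra.
pose t := ln (1 - delta) + ln (q%:R - 1) - ln delta.
have t_ge0 : 0 <= t.
  rewrite /t -lnM ?posrE // subr_ge0 ler_ln ?posrE ?mulr_gt0 //; nra.
exists ((1 - delta) * expR (- t)) => [|n]; first by rewrite mulr_gt0 ?expR_gt0.
set j := Num.truncn _.
have dn_ge0 : 0 <= delta * n%:R by rewrite mulr_ge0 ?ler0n ?ltW.
have j_itv : j%:R <= delta * n%:R < j.+1%:R by exact: truncn_itv.
have j_le_n : (j <= n)%N.
  rewrite -(ler_nat R); case/andP: j_itv => /le_trans + _; apply.
  by rewrite ler_piMl ?ler0n //; lra.
have bin_ge : (1 - delta) / n.+1%:R <= binomial_term delta n j.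
  by apply: binomial_term_ge => //; lra.
have expE (x : R) (i : nat) : 0 < x -> x ^+ i = expR (i%:R * ln x).
  by move=> x0; rewrite expRM_natl lnK ?posrE.
have -> : ('C(n, j) * q.-1 ^ j)%:R = binomial_term delta n j *
    expR (j%:R * ln (q%:R - 1) - j%:R * ln delta - (n%:R - j%:R) * ln (1 - delta)) :> R.
  rewrite natrM natrX -subn1 natrB 1?ltnW // /binomial_term !expE // -!mulrA -!expRD.
  by congr (_ * expR _); rewrite natrB //; ring.
have -> : (1 - delta) * expR (- t) / n.+1%:R * expR (n%:R * (ln q%:R * hq q delta)) =
    (1 - delta) / n.+1%:R * expR (n%:R * (ln q%:R * hq q delta) - t).
  by rewrite addrC expRD; ring.
apply: ler_pM => //; rewrite ?expR_ge0 ?divr_ge0 ?ler0n ?(ltW e0) // ler_expR ln_hq //; last lra.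
case/andP: j_itv => _; rewrite -natr1 => j_gt.
have : 0 <= t * (j%:R + 1 - delta * n%:R) by rewrite mulr_ge0 // subr_ge0 ltW.
by rewrite /t; lra.
Qed.

(** * The ideal spanned by the sum of all group elements *)

Lemma card_preimset_surj (U V : finType) (f : U -> V) (L : {set V}) :
  (forall u1 u2 : U, exists2 h : U -> U,
     injective h & forall u, f u = f u1 -> f (h u) = f u2) ->
  (forall v, exists u, f u = v) ->
  (#|f @^-1: L| * #|V| = #|L| * #|U|)%N.
Proof.
move=> fhom fsurj; have := card_preimset_homogeneous L fhom.
have -> : f @: [set: U] = [set: V].
  by apply/setP => v; have [u <-] := fsurj v; rewrite imset_f ?inE.
by rewrite finset.setIT cardsT.
Qed.

Definition augmentation (F : finFieldType) (G : finZmodType) (a : {ffun G -> F}) : F :=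
  \sum_x a x.

(* The word over F whose multiple by the sum of all group elements is the codeword of
   the vector (1, beta) times the sum of all group elements. *)
Definition trivial_word (F : finFieldType) (G : finZmodType) (k n : nat)
    (beta : {ffun 'I_k -> F}) (A : 'M[{ffun G -> F}]_(k.+1, n)) : {ffun 'I_n -> F} :=
  [ffun j => augmentation (A ord0 j) +
             \sum_i beta i * augmentation (A (lift ord0 i) j)].

(** Constant functions are the multiples of the sum of all group elements. The leading 1 makes any
    two vectors with distinct [beta] linearly independent over F. *)
Definition trivial_vector (F : finFieldType) (G : finZmodType) (k : nat)
    (beta : {ffun 'I_k -> F}) : {ffun 'I_k.+1 -> {ffun G -> F}} :=
  [ffun i => [ffun=> if unlift ord0 i is Some i' then beta i' else 1]].

(** The product with a constant function sees only the augmentation and is again constant on [G]. *)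
Lemma codeword_trivial_vector (F : finFieldType) (G : finZmodType) (k n : nat)
    (beta : {ffun 'I_k -> F}) (A : 'M[{ffun G -> F}]_(k.+1, n)) j z :
  codeword (trivial_vector G beta) A j z = trivial_word beta A j.
Proof.
have gmul_const (t : F) (a : {ffun G -> F}) : gmul [ffun=> t] a z = t * augmentation a.
  rewrite ffunE mulr_sumr [RHS](reindex_inj (subrI z)) /=.
  by apply: eq_bigr => x _; rewrite ffunE.
rewrite codewordE sum_ffunE big_ord_recl [RHS]ffunE; congr (_ + _).
  have -> : trivial_vector G beta ord0 = [ffun=> 1] by rewrite ffunE unlift_none.
  by rewrite gmul_const mul1r.
apply: eq_bigr => i _.
have -> : trivial_vector G beta (lift ord0 i) = [ffun=> beta i] by rewrite ffunE liftK.
by rewrite gmul_const.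
Qed.

Lemma trivial_wordD (F : finFieldType) (G : finZmodType) (k n : nat)
    (beta : {ffun 'I_k -> F}) (A B : 'M[{ffun G -> F}]_(k.+1, n)) :
  trivial_word beta (A + B) = trivial_word beta A + trivial_word beta B.
Proof.
have augD (a b : {ffun G -> F}) : augmentation (a + b) = augmentation a + augmentation b.
  by rewrite /augmentation -big_split /=; apply: eq_bigr => x _; rewrite ffunE.
apply/ffunP => j; rewrite !ffunE mxE augD addrACA; congr (_ + _).
by rewrite -big_split /=; apply: eq_bigr => i _; rewrite mxE augD mulrDr.
Qed.

Lemma trivial_word_of_scalars (F : finFieldType) (G : finZmodType) (k n : nat)
    (beta : {ffun 'I_k -> F}) (M : 'M[F]_(k.+1, n)) :
  trivial_word beta (\matrix_(i, j) [ffun x : G => M i j * (x == 0)%:R]) =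
  [ffun j => M ord0 j + \sum_i beta i * M (lift ord0 i) j].
Proof.
have augE (c : F) : augmentation [ffun x : G => c * (x == 0)%:R] = c.
  rewrite /augmentation (bigD1 0) //= ffunE eqxx mulr1 big1 ?addr0 // => x /negbTE x0.
  by rewrite ffunE x0 mulr0.
apply/ffunP => j; rewrite !ffunE mxE augE; congr (_ + _).
by apply: eq_bigr => i _; rewrite mxE augE.
Qed.

Lemma trivial_word_surj (F : finFieldType) (G : finZmodType) (k n : nat)
    (beta : {ffun 'I_k -> F}) (u : {ffun 'I_n -> F}) :
  exists A : 'M[{ffun G -> F}]_(k.+1, n), trivial_word beta A = u.
Proof.
pose M : 'M[F]_(k.+1, n) := \matrix_(i, j) if i == ord0 then u j else 0.
exists (\matrix_(i, j) [ffun x : G => M i j * (x == 0)%:R]).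
rewrite trivial_word_of_scalars; apply/ffunP => j; rewrite ffunE mxE eqxx.
by rewrite big1 ?addr0 // => i _; rewrite mxE mulr0.
Qed.

Lemma trivial_word_pair_surj (F : finFieldType) (G : finZmodType) (k n : nat)
    (beta gamma : {ffun 'I_k -> F}) (u v : {ffun 'I_n -> F}) :
  beta != gamma ->
  exists A : 'M[{ffun G -> F}]_(k.+1, n),
    trivial_word beta A = u /\ trivial_word gamma A = v.
Proof.
move=> neq; have [i0 bg0] : exists i0, beta i0 - gamma i0 != 0.
  apply/existsP; apply: contraNT neq; rewrite negb_exists => /forallP bg.
  by apply/eqP/ffunP => i; apply/eqP; have := bg i; rewrite negbK subr_eq0.
(* With [w] in row [lift ord0 i0], the top row must equal both u - beta_i0 w and v - gamma_i0 w;
   this determines [w]. *)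
pose w j := (u j - v j) / (beta i0 - gamma i0).
pose M : 'M[F]_(k.+1, n) := \matrix_(i, j)
  if i == ord0 then u j - beta i0 * w j else if i == lift ord0 i0 then w j else 0.
exists (\matrix_(i, j) [ffun x : G => M i j * (x == 0)%:R]).
have sumM (c : {ffun 'I_k -> F}) j : \sum_i c i * M (lift ord0 i) j = c i0 * w j.
  rewrite (bigD1 i0) //= mxE eqxx big1 ?addr0 // => i ii0.
  by rewrite mxE /= (inj_eq lift_inj) (negbTE ii0) mulr0.
split; rewrite trivial_word_of_scalars; apply/ffunP => j; rewrite ffunE sumM mxE eqxx.
  by rewrite subrK.
by rewrite /w; field.
Qed.

(** The q^k words are uniform and pairwise independent: each lies in [L] with probability |L| / q^n,
    and two of them with its square, so [card_no_event_le] applies. *)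
Lemma card_trivial_word_avoid_le (R : realType) (F : finFieldType) (G : finZmodType)
    (k n : nat) (L : {set {ffun 'I_n -> F}}) :
  #|[pred A : 'M[{ffun G -> F}]_(k.+1, n) |
      [forall beta : {ffun 'I_k -> F}, trivial_word beta A \notin L]]|%:R *
  ((#|F| ^ k)%:R * (#|L|%:R / (#|F| ^ n)%:R)) <=
  #|{: 'M[{ffun G -> F}]_(k.+1, n)}|%:R :> R.
Proof.
have Q0 : (#|F| ^ n)%:R != 0 :> R.
  by rewrite pnatr_eq0 expn_eq0 negb_and -lt0n ltnW ?card_finNzRing_gt1.
have cardV : #|{: {ffun 'I_n -> F}}| = (#|F| ^ n)%N by rewrite card_ffun card_ord.
have homog (beta : {ffun 'I_k -> F}) (A1 A2 A : 'M[{ffun G -> F}]_(k.+1, n)) :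
    trivial_word beta A = trivial_word beta A1 ->
    trivial_word beta (A + (A2 - A1)) = trivial_word beta A2.
  by move=> AE; rewrite trivial_wordD AE -trivial_wordD addrC subrK.
rewrite -[k in (_ ^ k)%N]card_ord -card_ffun.
apply: (@card_no_event_le R _ _ (fun beta A => trivial_word beta A \in L)).
- by rewrite divr_ge0 ?ler0n.
- move=> beta.
  have := @card_preimset_surj _ _ (@trivial_word F G k n beta) L _ (trivial_word_surj G beta).
  rewrite cardV => cE; apply: (mulIf Q0); rewrite mulrAC divfK // -!natrM -cE.
    by congr (_ * _)%:R; apply: eq_card => A; rewrite !inE.
  move=> A1 A2; exists (fun A => A + (A2 - A1)); first exact: addIr.
  by move=> A; exact: homog.
- move=> beta gamma neq.
  pose f A := (@trivial_word F G k n beta A, @trivial_word F G k n gamma A).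
  have := @card_preimset_surj _ _ f (finset.setX L L).
  rewrite card_prod cardV cardsX => cE.
  apply: (mulIf (mulf_neq0 Q0 Q0)).
  rewrite expr2 mulrAC mulrACA !divfK // -!natrM -cE.
  - by congr (_ * _)%:R; apply: eq_card => A; rewrite !inE.
  - move=> A1 A2; exists (fun A => A + (A2 - A1)); first exact: addIr.
    by move=> A [AE1 AE2]; congr (_, _); apply: homog.
  - move=> [u v]; have [A [<- <-]] := trivial_word_pair_surj G u v neq.
    by exists A.
Qed.

(** * Above the GV bound: the second moment *)

(** The codeword repeats each symbol |G| times, so relative weights agree. Positive weight makes the
    codeword nonzero and hence counted in [minwt]. *)
Lemma relDist_le (R : realType) (F : finFieldType) (G : finZmodType) (k n : nat)
    (delta : R) (beta : {ffun 'I_k -> F}) (A : 'M[{ffun G -> F}]_(k.+1, n)) :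
  (0 < #|supp (trivial_word beta A)|)%N ->
  #|supp (trivial_word beta A)|%:R <= delta * n%:R -> relDist R A <= delta.
Proof.
set f := trivial_word beta A => f_gt0 f_le.
have m_gt0 : (0 < #|G|)%N by apply/card_gt0P; exists 0.
have n_gt0 : (0 < n)%N by case/card_gt0P: f_gt0 => j _; exact: leq_ltn_trans (ltn_ord j).
rewrite /relDist ler_pdivrMr ?ltr0n ?muln_gt0 ?m_gt0 //.
have nz : nonzero_word (codeword (trivial_vector G beta) A).
  case/card_gt0P: f_gt0 => j; rewrite inE => fj.
  by apply/existsP; exists j; apply/existsP; exists 0; rewrite codeword_trivial_vector.
apply: (@le_trans _ _ (hweight (codeword (trivial_vector G beta) A))%:R).
  rewrite ler_nat /minwt -leEnat -minEnat.
  exact: (bigmin_le_cond _ (fun b => hweight (codeword b A)) nz).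
have -> : hweight (codeword (trivial_vector G beta) A) = (#|G| * #|supp f|)%N.
  rewrite /hweight mulnC -sum_nat_const [RHS]big_mkcond /=; apply: eq_bigr => j _.
  rewrite inE; case: ifPn => fj.
    by apply: eq_card => z; rewrite !inE codeword_trivial_vector fj.
  by apply: eq_card0 => z; rewrite !inE codeword_trivial_vector (negbTE fj).
by rewrite !natrM mulrCA ler_wpM2l ?ler0n.
Qed.

Lemma prob_dist_gt_ge0 (R : realType) (F : finFieldType) (G : finZmodType) (k n : nat)
    (delta : R) : 0 <= prob_dist_gt F G k n delta.
Proof. by rewrite divr_ge0 ?ler0n. Qed.

Lemma prob_dist_gt_le1 (R : realType) (F : finFieldType) (G : finZmodType) (k n : nat)
    (delta : R) : prob_dist_gt F G k n delta <= 1.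
Proof.
rewrite /prob_dist_gt ler_pdivrMr ?mul1r ?ler_nat ?max_card // ltr0n.
by apply/card_gt0P; exists 0.
Qed.

(** If the relative distance exceeds delta, no [trivial_word] has weight exactly [j]. One of the k +
    1 rows carries the coefficient 1, which leaves q^k choices of beta. *)
Lemma prob_dist_gt_upper (R : realType) (F : finFieldType) (G : finZmodType)
    (k n j : nat) (delta : R) :
  (0 < j)%N -> j%:R <= delta * n%:R ->
  prob_dist_gt F G k.+1 n delta *
    ((#|F| ^ k)%:R * ('C(n, j) * #|F|.-1 ^ j)%:R) <= (#|F| ^ n)%:R.
Proof.
move=> j_gt0 j_le.
pose L := [set f : {ffun 'I_n -> F} | #|supp f| == j].
have cardL : #|L| = ('C(n, j) * #|F|.-1 ^ j)%N by rewrite card_weight card_ord.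
have Q0 : 0 < (#|F| ^ n)%:R :> R by rewrite ltr0n expn_gt0 ltnW ?card_finNzRing_gt1.
have M0 : 0 < #|{: 'M[{ffun G -> F}]_(k.+1, n)}|%:R :> R.
  by rewrite ltr0n; apply/card_gt0P; exists 0.
rewrite -cardL /prob_dist_gt mulrAC ler_pdivrMr // -ler_pdivrMl // mulrC -!mulrA.
apply: le_trans (card_trivial_word_avoid_le R G k L).
rewrite ler_wpM2r ?mulr_ge0 ?invr_ge0 ?ler0n // ler_nat; apply: subset_leq_card.
apply/subsetP => A; rewrite !inE => A_gt; apply/forallP => beta.
apply: contraL A_gt; rewrite inE -leNgt => /eqP wE.
by apply: (@relDist_le _ _ _ _ _ _ beta); rewrite wE.
Qed.

(** Absorbs the linear loss in [card_weight_entropy_ge]; it follows from 1 + a n <= e^(a n). *)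
Lemma natrS_le_expR (R : realType) (a : R) (n : nat) :
  0 < a -> n.+1%:R <= (1 + a^-1) * expR (a * n%:R).
Proof.
move=> a0; have := expR_ge1Dx (a * n%:R); have := ler0n R n.
set N := n%:R => N0 le_e; rewrite -natr1 -/N mulrDl mul1r addrC lerD //.
  by apply: le_trans le_e; rewrite lerDl mulr_ge0 // ltW.
by rewrite ler_pdivlMl // (le_trans _ le_e) // lerDr.
Qed.

Lemma prob_dist_gt_exp_small (R : realType) (F : finFieldType) (G : finZmodType)
    (r delta : R) :
  0 < r -> 0 < delta < 1 - #|F|%:R^-1 -> gq #|F| delta < r ->
  exists c C : R, exists n0 : nat, 0 < c /\ forall n, (n0 <= n)%N ->
    `|prob_dist_gt F G (nearest_k r n) n delta| <= C * expR (- (c * n%:R)).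
Proof.
move=> r0 d01 g_lt.
have q1 := card_finNzRing_gt1 F.
have q0 : 0 < #|F|%:R :> R by rewrite ltr0n ltnW.
have L0 : 0 < ln (#|F|%:R : R) by rewrite ln_gt0 // ltr1n.
have [K K0 cardL_ge] := card_weight_entropy_ge q1 d01.
have d0 : 0 < delta by case/andP: d01.
(* Half of the decay rate; the other half pays for the factor n + 1. *)
pose a := ln #|F|%:R * (r - gq #|F| delta) / 2.
have a0 : 0 < a by rewrite divr_gt0 // mulr_gt0 // subr_gt0.
(* The factor q^2 pays for rounding: with k + 1 rows, k + 2 > r n. *)
exists a, (K^-1 * (1 + a^-1) * expR (2 * ln #|F|%:R)).
(* From here on delta n >= 1 and r n >= 1, so the weight floor(delta n) and the number of rows are
   positive. *)
exists (Num.truncn (delta^-1 + r^-1)).+1; split=> // n n_ge.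
have n_gt : delta^-1 + r^-1 <= n%:R.
  by rewrite (le_trans (ltW (truncnS_gt _))) // ler_nat.
have dV : 0 < delta^-1 by rewrite invr_gt0.
have rV : 0 < r^-1 by rewrite invr_gt0.
have dn1 : 1 <= delta * n%:R by rewrite -ler_pdivrMl // mulr1; lra.
have rn1 : 1 <= r * n%:R by rewrite -ler_pdivrMl // mulr1; lra.
rewrite ger0_norm ?prob_dist_gt_ge0 //.
have /andP[k_gt _] := nearest_k_bounds n r0.
case: (nearest_k r n) k_gt => [|k] k_gt; first by exfalso; lra.
have dn0 : 0 <= delta * n%:R by lra.
have /andP[j_le _] := truncn_itv dn0.
have j_gt0 : (0 < Num.truncn (delta * n%:R))%N by rewrite truncn_gt0.
have := @prob_dist_gt_upper R F G k n _ delta j_gt0 j_le.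
set p := prob_dist_gt _ _ _ _ _; set N := (_ * _)%:R => p_le.
have N_ge := cardL_ge n; rewrite -/N in N_ge.
have expE (i : nat) : (#|F| ^ i)%:R = expR (i%:R * ln #|F|%:R) :> R.
  by rewrite natrX expRM_natl lnK ?posrE.
rewrite !expE in p_le.
set H := n%:R * (ln #|F|%:R * hq #|F| delta) in N_ge.
have n1 : 0 < n.+1%:R :> R by rewrite ltr0n.
have {p_le} p_le : p * (expR (k%:R * ln #|F|%:R) * (K / n.+1%:R * expR H)) <=
    expR (n%:R * ln #|F|%:R).
  by apply: le_trans p_le; rewrite ler_wpM2l ?prob_dist_gt_ge0 // ler_wpM2l ?expR_ge0.
have {p_le} p_le : p <= K^-1 * n.+1%:R *
    expR (n%:R * ln #|F|%:R - k%:R * ln #|F|%:R - H).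
  rewrite !expRD !expRN.
  move: p_le; rewrite -ler_pdivlMr; last by rewrite !mulr_gt0 ?expR_gt0 ?invr_gt0.
  move/le_trans; apply; rewrite le_eqVlt; apply/orP; left; apply/eqP.
  by field; rewrite !gt_eqF ?expR_gt0.
apply: (le_trans p_le); rewrite -!mulrA ler_pM2l ?invr_gt0 //.
apply: (@le_trans _ _ ((1 + a^-1) * expR (a * n%:R) *
    expR (n%:R * ln #|F|%:R - k%:R * ln #|F|%:R - H))).
  by rewrite ler_wpM2r ?expR_ge0 // natrS_le_expR.
rewrite -!mulrA ler_pM2l ?addr_gt0 ?invr_gt0 // -!expRD ler_expR.
rewrite -[k.+1%:R]natr1 in k_gt.
have : 0 <= ln #|F|%:R * (k%:R + 2 - r * n%:R) by rewrite mulr_ge0 ?(ltW L0) //; lra.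
by rewrite /H /a /gq; lra.
Qed.

(** * Convergence and exponential rate *)

Local Open Scope classical_set_scope.

Theorem theorem2p1 (R : realType) (F : finFieldType) (G : finZmodType)
    (r delta : R) :
  0 < r < 1 -> 0 < delta < 1 - (#|F|%:R)^-1 ->
  let p := fun n : nat => prob_dist_gt F G (nearest_k r n) n delta in
  (r < gq #|F| delta ->
     p n @[n --> \oo] --> (1 : R) /\
     exists c C : R, 0 < c /\ forall n : nat, `|p n - 1| <= C * expR (- (c * n%:R))) /\
  (gq #|F| delta < r ->
     p n @[n --> \oo] --> (0 : R) /\
     exists c C : R, 0 < c /\ forall n : nat, `|p n - 0| <= C * expR (- (c * n%:R))).
Proof.
move=> /andP[r0 r1] d01 p.
have q1 := card_finNzRing_gt1 F.
have L0 : 0 < ln (#|F|%:R : R) by rewrite ln_gt0 // ltr1n.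
have p_ge0 n : 0 <= p n by exact: prob_dist_gt_ge0.
have p_le1 n : p n <= 1 by exact: prob_dist_gt_le1.
have conclude l c C n0 : 0 < c -> (forall n, `|p n - l| <= 1) ->
    (forall n, (n0 <= n)%N -> `|p n - l| <= C * expR (- (c * n%:R))) ->
    p n @[n --> \oo] --> l /\
    exists c C : R, 0 < c /\ forall n : nat, `|p n - l| <= C * expR (- (c * n%:R)).
  move=> c0 p1 pC; have [c' [C' [c'0 pC']]] := expR_bound_extend c0 p1 pC.
  by split; [exact: cvg_of_expR_bound c'0 pC' | exists c', C'].
split=> [r_lt|r_gt].
  (* The index n = 0 is left out: there division by the length 0 makes the relative distance 0. *)
  apply: (conclude _ (ln #|F|%:R * (gq #|F| delta - r)) _ 1) => [||n n_gt0].
  - by rewrite mulr_gt0 // subr_gt0.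
  - by move=> n; rewrite distrC ger0_norm ?subr_ge0 // gerBl.
  - exact: (prob_dist_gt_lower G n_gt0 r0 d01 r_lt).
have [c [C [n0 [c0 pC]]]] := prob_dist_gt_exp_small G r0 d01 r_gt.
apply: (conclude _ _ _ _ c0) => n; first by rewrite subr0 ger0_norm.
by rewrite subr0; exact: pC.
Qed.
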